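(* Consider the problem and Algorithm 1 as described in the context, under the standing assumptions. Let the parameters satisfy $$0<p=\gamma\le \tfrac{1}{16},\qquad \eta=\min\Big\{\frac{\sqrt{\gamma b}}{8\bar L},\ \frac{1}{8L}\Big\},$$ let $K\ge 1$, and let $\bar x^K=\frac1K\sum_{k=0}^{K-1}x^{k+1}$. Then for every nonempty compact set $\mathcal C\subseteq\mathbb R^d$, $$\mathbb E\big[\mathrm{Gap}_{\mathcal C}(\bar x^K)\big]\le \frac{2}{\eta K}\max_{x\in\mathcal C}\|x^0-x\|^2 .$$ Consequently, setting $D^2=\max_{x\in\mathcal C}\|x^0-x\|^2$, given $\varepsilon>0$ one has $\mathbb E[\mathrm{Gap}_{\mathcal C}(\bar x^K)]\le\varepsilon$ after $$K=\mathcal O\Big(\frac{1}{\sqrt{pb}}\cdot\frac{\bar L D^2}{\varepsilon}+\frac{L D^2}{\varepsilon}\Big)$$ iterations.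
   Context: Let $g:\mathbb R^d\to\mathbb R\cup\{+\infty\}$ be proper, convex and lower semicontinuous, with $\mathrm{dom}\, g=\{x:g(x)<+\infty\}$ and $\mathrm{prox}_{\alpha g}(x)=\arg\min_y\{\alpha g(y)+\tfrac12\|y-x\|^2\}$ for $\alpha>0$. Let $F=\frac1M\sum_{m=1}^M F_m$ where $F_1,\dots,F_M:\mathbb R^d\to\mathbb R^d$ are single-valued operators. Standing assumptions: the variational inequality (find $x^*$ with $\langle F(x^* ),x-x^*\rangle+g(x)-g(x^* )\ge0$ for all $x$) has a solution; $F$ is monotone, $\langle F(u)-F(v),u-v\rangle\ge0$ for all $u,v$; $F$ is $L$-Lipschitz; each $F_m$ is $L_m$-Lipschitz, and $\bar L^2:=\frac1M\sum_{m=1}^M L_m^2$. Algorithm 1 (Optimistic Method with Momentum and Batching), with stepsize $\eta>0$, momentum $\gamma>0$, probability $p\in(0,1)$, batch size $b\in\{1,\dots,M\}$: initialize $x^0=w^0=x^{-1}=w^{-1}\in\mathbb R^d$. For $k=0,1,\dots$: sample $j^k_1,\dots,j^k_b$ independently and uniformly at random from $\{1,\dots,M\}$ and set $S^k=\{j^k_1,\dots,j^k_b\}$ (a multiset; sums over $S^k$ run over the $b$ samples); set $$\Delta^k=\frac1b\sum_{j\in S^k}\Big(F_j(x^k)-F_j(w^{k-1})+\big(F_j(x^k)-F_j(x^{k-1})\big)\Big)+F(w^{k-1});$$ set $x^{k+1}=\mathrm{prox}_{\eta g}\big(x^k+\gamma(w^k-x^k)-\eta\Delta^k\big)$; and set $w^{k+1}=x^{k+1}$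 with probability $p$ and $w^{k+1}=w^k$ with probability $1-p$, independently of everything else. For a nonempty compact set $\mathcal C\subseteq\mathbb R^d$, the gap function is $\mathrm{Gap}_{\mathcal C}(z)=\sup_{u\in\mathcal C}\big[\langle F(u),z-u\rangle+g(z)-g(u)\big]$. *)

(* Defs.v *)
From HB Require Import structures.
From mathcomp Require Import all_boot all_order all_algebra.
From mathcomp Require Import all_classical all_reals all_analysis.
Set Implicit Arguments. Unset Strict Implicit. Unset Printing Implicit Defensive.
Import Order.TTheory GRing.Theory Num.Theory.
Import numFieldNormedType.Exports.
Local Open Scope classical_set_scope.
Local Open Scope ring_scope.

Section Defs.
Variables (R : realType) (d : nat).
Notation vec := 'rV[R]_d.

Definition dotv (u v : vec) : R := \sum_(i < d) u ord0 i * v ord0 i.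
Definition norm2 (u : vec) : R := dotv u u.
Definition enorm (u : vec) : R := Num.sqrt (norm2 u).

Definition proper_fun (g : vec -> \bar R) : Prop :=
  (forall x, g x != -oo%E) /\ (exists x, (g x < +oo)%E).
Definition convex_efun (g : vec -> \bar R) : Prop :=
  forall (x y : vec) (t : R), 0 <= t <= 1 ->
    (g (t *: x + (1 - t) *: y)%R <= t%:E * g x + (1 - t)%:E * g y)%E.

(* prox_{a g}(x) = argmin_y { a g(y) + 1/2 ||y - x||^2 } (chosen minimizer;
   unique under the standing assumptions) *)
Definition is_prox (g : vec -> \bar R) (a : R) (x p : vec) : Prop :=
  forall y, (a%:E * g p + (norm2 (p - x)%R / 2)%:E
              <= a%:E * g y + (norm2 (y - x)%R / 2)%:E)%E.
Definition prox (g : vec -> \bar R) (a : R) (x : vec) : vec :=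
  xget 0 [set p | is_prox g a x p].

Definition monotone_op (F : vec -> vec) : Prop :=
  forall u v, 0 <= dotv (F u - F v) (u - v).
Definition lipschitz_op (F : vec -> vec) (L : R) : Prop :=
  forall u v, enorm (F u - F v) <= L * enorm (u - v).

Definition vi_solution (F : vec -> vec) (g : vec -> \bar R) (xs : vec) : Prop :=
  forall x, (0 <= (dotv (F xs) (x - xs)%R)%:E + g x - g xs)%E.

Definition gap (F : vec -> vec) (g : vec -> \bar R) (C : set vec) (z : vec) : \bar R :=
  ereal_sup [set ((dotv (F u) (z - u)%R)%:E + g z - g u)%E | u in C].

Variables (M b : nat).
(* randomness of one iteration: the b samples j_1..j_b and the coin for w *)
Definition outcome := (b.-tuple 'I_M * bool)%type.

Definition Favg (Fm : 'I_M -> vec -> vec) (x : vec) : vec :=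
  (M%:R)^-1 *: \sum_(m < M) Fm m x.

(* state (x^k, x^{k-1}, w^k, w^{k-1}) *)
Record state := State { sx : vec; sxp : vec; sw : vec; swp : vec }.

Definition alg_step (Fm : 'I_M -> vec -> vec) (g : vec -> \bar R)
    (eta gamma : R) (s : state) (o : outcome) : state :=
  let: (Sk, c) := o in
  let: State xk xk1 wk wk1 := s in
  let Delta := (b%:R)^-1 *: \sum_(j <- Sk) (Fm j xk - Fm j wk1 + (Fm j xk - Fm j xk1))
               + Favg Fm wk1 in
  let xn := prox g eta (xk + gamma *: (wk - xk) - eta *: Delta) in
  let wn := if c then xn else wk in
  State xn xk wn wk.

Definition alg_init (x0 : vec) : state := State x0 x0 x0 x0.

Definition run Fm g eta gamma (x0 : vec) (os : seq outcome) : state :=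
  foldl (alg_step Fm g eta gamma) (alg_init x0) os.

Definition xbar Fm g eta gamma x0 (K : nat) (t : K.-tuple outcome) : vec :=
  (K%:R)^-1 *: \sum_(k < K) sx (run Fm g eta gamma x0 (take k.+1 t)).

Definition outcome_prob (p : R) (o : outcome) : R :=
  (M%:R ^+ b)^-1 * (if o.2 then p else 1 - p).
Definition path_prob (p : R) (K : nat) (t : K.-tuple outcome) : R :=
  \prod_(o <- t) outcome_prob p o.

Definition expected_gap Fm g eta gamma p x0 (C : set vec) (K : nat) : \bar R :=
  (\sum_(t : K.-tuple outcome)
     (path_prob p t)%:E * gap (Favg Fm) g C (xbar Fm g eta gamma x0 t))%E.

End Defs.

(* Main.v *)
(* Write e^k for the sampling noise Delta^k - (2 F(x^k) - F(x^{k-1})) and om^k for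
   the coin noise w^{k+1} - (p x^{k+1} + (1-p) w^k).  The prox inequality and
   monotonicity give, for every u, a telescoping bound on the gap at u plus the
   term <N, u - x^0>, where N is the sum of the martingale differences
   xi^k = 2 eta e^k - 2 om^k: this is the only place where the noise meets u.
   Bounding it by 2 |u - x^0|^2 + |N|^2 / 8 removes u from the noise, so the
   supremum over u can be taken before the expectation, and yields pathwise
     2 eta K Gap <= 4 D^2 + W_K.
   The step size makes W_K a supermartingale with W_0 = 0: the increments of
   E |N|^2 are variances, which the negative terms - |x^{k+1} - x^k|^2 and
   - gamma |x^{k+1} - w^k|^2 absorb. *)

Require Import Defs.
From HB Require Import structures.
From mathcomp Require Import all_boot all_order all_algebra.
From mathcomp Require Import all_classical all_reals all_analysis.
From mathcomp Require Import ring lra.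
Import Order.TTheory GRing.Theory Num.Theory.
Import numFieldNormedType.Exports.
Local Open Scope classical_set_scope.
Local Open Scope ring_scope.

Set Implicit Arguments.
Unset Strict Implicit.

(** * Inner product and squared norm on row vectors *)

Section Euclidean.
Context {R : realType} {d : nat}.
Implicit Types u v w : 'rV[R]_d.

Lemma dotvC u v : dotv u v = dotv v u.
Proof. by apply: eq_bigr => i _; rewrite mulrC. Qed.

Lemma dotvDl u v w : dotv (u + v) w = dotv u w + dotv v w.
Proof. by rewrite /dotv -big_split /=; apply: eq_bigr => i _; rewrite mxE mulrDl. Qed.

Lemma dotvZl (a : R) u v : dotv (a *: u) v = a * dotv u v.
Proof. by rewrite /dotv big_distrr /=; apply: eq_bigr => i _; rewrite mxE mulrA. Qed.

Lemma dotvDr u v w : dotv w (u + v) = dotv w u + dotv w v.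
Proof. by rewrite dotvC dotvDl !(dotvC w). Qed.

Lemma dotvZr (a : R) u v : dotv u (a *: v) = a * dotv u v.
Proof. by rewrite dotvC dotvZl dotvC. Qed.

Lemma dotvNl u v : dotv (- u) v = - dotv u v.
Proof. by rewrite -scaleN1r dotvZl mulN1r. Qed.

Lemma dotvNr u v : dotv u (- v) = - dotv u v.
Proof. by rewrite dotvC dotvNl dotvC. Qed.

Lemma dotv0 u : dotv u 0 = 0.
Proof. by rewrite -(scale0r 0) dotvZr mul0r. Qed.

Definition dotvE := (dotvDl, dotvDr, dotvNl, dotvNr, dotvZl, dotvZr).

Lemma dotv_sumr (I : Type) (r : seq I) (P : pred I) (f : I -> 'rV[R]_d) u :
  dotv u (\sum_(i <- r | P i) f i) = \sum_(i <- r | P i) dotv u (f i).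
Proof. exact: (big_morph _ (fun x y => dotvDr x y u) (dotv0 u)). Qed.

Lemma norm2_ge0 u : 0 <= norm2 u.
Proof. by apply: sumr_ge0 => i _; rewrite -expr2 sqr_ge0. Qed.

Lemma norm20 : norm2 (0 : 'rV[R]_d) = 0.
Proof. exact: dotv0. Qed.

Lemma norm2Z (a : R) u : norm2 (a *: u) = a ^+ 2 * norm2 u.
Proof. by rewrite /norm2 dotvZl dotvZr mulrA. Qed.

Lemma norm2D u v : norm2 (u + v) = norm2 u + 2 * dotv u v + norm2 v.
Proof. by rewrite /norm2 !dotvE (dotvC v u); ring. Qed.

Lemma norm2BC u v : norm2 (u - v) = norm2 (v - u).
Proof. by rewrite -opprB -scaleN1r norm2Z sqrrN expr1n mul1r. Qed.

Lemma young u v (t : R) : 0 < t -> 2 * dotv u v <= t * norm2 u + t^-1 * norm2 v.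
Proof.
move=> t0; have := norm2_ge0 (t *: u - v).
rewrite norm2D norm2Z -scaleN1r norm2Z dotvZl dotvZr => h.
rewrite -(ler_pM2l t0) mulrDr !mulrA mulfV ?gt_eqF//.
by move: h; nra.
Qed.

Lemma norm2D_le u v : norm2 (u + v) <= 2 * (norm2 u + norm2 v).
Proof. by have := young u v ltr01; rewrite norm2D invr1; lra. Qed.

Lemma enorm_sqr u : enorm u ^+ 2 = norm2 u.
Proof. by rewrite sqr_sqrtr ?norm2_ge0. Qed.

Lemma lipschitz_norm2 (F : 'rV[R]_d -> 'rV[R]_d) (L : R) u v :
  lipschitz_op F L -> norm2 (F u - F v) <= L ^+ 2 * norm2 (u - v).
Proof.
move=> /(_ u v) FL; rewrite -!enorm_sqr -exprMn lerXn2r// nnegrE ?sqrtr_ge0//.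
exact: le_trans (sqrtr_ge0 _) FL.
Qed.

End Euclidean.

(** * Expectation over finite sequences of independent outcomes *)

Section ProductExpectation.
Context {R : realType} {T : finType} (mu : T -> R).

(** Serves both for the [b] samples of a batch and for the outcomes of a whole run. Since [f] acts
    on plain sequences, one [f] works for every [n] and [rcons] needs no length cast. *)
Definition Ex (n : nat) (f : seq T -> R) : R :=
  \sum_(t : n.-tuple T) (\prod_(o <- t) mu o) * f t.

Lemma Ex0 f : Ex 0 f = f [::].
Proof.
rewrite /Ex (bigD1 [tuple]) //= big_nil mul1r big1 ?addr0// => t.
by case/eqP; exact: tuple0.
Qed.

(** Conditioning on the past: the last outcome is integrated first. *)
Lemma ExS n f : Ex n.+1 f = Ex n (fun s => \sum_o mu o * f (rcons s o)).
Proof.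
pose h (q : n.-tuple T * T) : n.+1.-tuple T := [tuple of rcons q.1 q.2].
have h_inj : injective h.
  move=> [s x] [t y] /(congr1 (@tval _ _)) /= /rcons_inj[/val_inj -> ->].
  by [].
rewrite /Ex (reindex h) /=; last first.
  by apply/onW_bij/inj_card_bij; rewrite // card_prod !card_tuple expnSr.
rewrite -(pair_bigA _ (fun (s : n.-tuple T) o =>
  (\prod_(i <- rcons s o) mu i) * f (rcons s o))) /=.
apply: eq_bigr => s _; rewrite big_distrr /=; apply: eq_bigr => o _.
by rewrite big_rcons /=; ring.
Qed.

Lemma ExD n f1 f2 : Ex n (fun s => f1 s + f2 s) = Ex n f1 + Ex n f2.
Proof. by rewrite /Ex -big_split /=; apply: eq_bigr => s _; rewrite mulrDr. Qed.

Lemma ExZ n a f : Ex n (fun s => a * f s) = a * Ex n f.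
Proof. by rewrite /Ex big_distrr /=; apply: eq_bigr => s _; rewrite mulrCA. Qed.

Hypothesis mu_ge0 : forall o, 0 <= mu o.
Hypothesis mu_sum1 : \sum_o mu o = 1.

Lemma Ex_cst n a : Ex n (fun=> a) = a.
Proof.
elim: n => [|n IH]; first by rewrite Ex0.
by rewrite ExS -big_distrl /= mu_sum1 mul1r.
Qed.

Lemma Ex_le n f1 f2 : (forall s, size s = n -> f1 s <= f2 s) -> Ex n f1 <= Ex n f2.
Proof.
move=> f12; apply: ler_sum => t _; rewrite ler_wpM2l ?f12 ?size_tuple//.
exact: prodr_ge0.
Qed.

Lemma Ex_supermartingale n W :
  (forall s, \sum_o mu o * W (rcons s o) <= W s) -> Ex n W <= W [::].
Proof.
move=> Wle; elim: n => [|n IH]; first by rewrite Ex0.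
by rewrite ExS; apply: le_trans IH; apply: Ex_le => s _.
Qed.

(** The two sides differ by exactly [norm2 m]. *)
Lemma variance_le {d : nat} (Y : T -> 'rV[R]_d) (m := \sum_o mu o *: Y o) :
  \sum_o mu o * norm2 (Y o - m) <= \sum_o mu o * norm2 (Y o).
Proof.
have mE : \sum_o mu o * dotv m (Y o) = norm2 m.
  by rewrite /norm2 {3}/m dotv_sumr; apply: eq_bigr => o _; rewrite dotvZr.
have -> : \sum_o mu o * norm2 (Y o - m) = \sum_o mu o * norm2 (Y o) - norm2 m.
  transitivity (\sum_o (mu o * norm2 (Y o) + (-2) * (mu o * dotv m (Y o)) + mu o * norm2 m)).
    apply: eq_bigr => o _.
    by rewrite norm2D -scaleN1r norm2Z dotvZr (dotvC m); ring.
  rewrite !big_split /= -big_distrr /= mE -big_distrl /= mu_sum1; ring.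
by rewrite gerBl norm2_ge0.
Qed.

Section CenteredSums.
Context {d : nat} (c : T -> 'rV[R]_d).
Hypothesis c_centered : \sum_o mu o *: c o = 0.

Lemma centered_dotv a : \sum_o mu o * dotv a (c o) = 0.
Proof.
transitivity (dotv a (\sum_o mu o *: c o)); last by rewrite c_centered dotv0.
by rewrite dotv_sumr; apply: eq_bigr => o _; rewrite dotvZr.
Qed.

Lemma Ex_dotv_sum n a : Ex n (fun s => dotv a (\sum_(o <- s) c o)) = 0.
Proof.
elim: n => [|n IH]; first by rewrite Ex0 big_nil dotv0.
rewrite ExS -[RHS]IH; congr Ex; apply/funext => s.
under eq_bigr do rewrite big_rcons dotvDr mulrDr.
by rewrite big_split /= centered_dotv -big_distrl /= mu_sum1; ring.
Qed.

(** Cross terms vanish, because the partial sum does not depend on the new centered term. *)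
Lemma Ex_norm2_sum n :
  Ex n (fun s => norm2 (\sum_(o <- s) c o)) = n%:R * \sum_o mu o * norm2 (c o).
Proof.
elim: n => [|n IH]; first by rewrite Ex0 big_nil norm20 mul0r.
rewrite ExS -natr1 mulrDl mul1r -IH -[X in _ = _ + X](Ex_cst n) -ExD.
congr Ex; apply/funext => s.
set S := \sum_(o <- s) c o.
transitivity (\sum_o (mu o * norm2 S + 2 * (mu o * dotv S (c o)) + mu o * norm2 (c o))).
  apply: eq_bigr => o _.
  by rewrite big_rcons /= norm2D -/S (dotvC S); ring.
rewrite !big_split /= -big_distrr /= centered_dotv -big_distrl /= mu_sum1; ring.
Qed.

End CenteredSums.
End ProductExpectation.

(** * Existence and variational inequality of the proximal point *)

Section Prox.
Context {R : realType} {d : nat}.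
Implicit Types (g : 'rV[R]_d -> \bar R) (x y u : 'rV[R]_d).

Lemma continuous_norm2B x : continuous (fun y => norm2 (y - x)).
Proof.
move=> y; apply: (@cvg_big R^o _ +%R 0 predT (@add_continuous R^o) _ (nbhs y)) => i _.
have cB : {for y, continuous (fun z : 'rV[R]_d => (z - x) ord0 i)}.
  have -> : (fun z : 'rV[R]_d => (z - x) ord0 i) = (fun z => z ord0 i - x ord0 i).
    by apply/funext => z; rewrite !mxE.
  apply: (@continuousB _ R^o); [exact: coord_continuous | exact: cst_continuous].
exact: (@continuousM _ _ _ _ y cB cB).
Qed.

Lemma has_sup_norm2B x (C : set 'rV[R]_d) :
  C !=set0 -> compact C -> has_sup [set norm2 (x - y) | y in C].
Proof.
move=> C0 Cc; under eq_imagel => y _ do rewrite norm2BC.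
apply: compact_has_sup; first exact: image_nonempty.
apply: continuous_compact => //.
exact/continuous_subspaceT/continuous_norm2B.
Qed.

Lemma proper_fine g x : proper_fun g -> (g x < +oo)%E -> g x = (fine (g x))%:E.
Proof. by move=> [gNy _] gx; rewrite fineK// fin_numE gNy -ltey. Qed.

(* At [xs] the value of [g] is finite because [+oo - +oo = -oo] in [\bar R]. *)
Lemma vi_solution_minorant (F : 'rV[R]_d -> 'rV[R]_d) g xs :
  proper_fun g -> vi_solution F g xs ->
  exists m c, forall x, ((m + dotv c x)%:E <= g x)%E.
Proof.
move=> gp vi; have [gNy [x1 gx1]] := gp.
have gxs : (g xs < +oo)%E.
  rewrite ltey; apply/eqP => gxs; have := vi x1.
  by rewrite gxs (proper_fine gp gx1).
exists (fine (g xs) + dotv (F xs) xs), (- F xs) => x.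
have := vi x; rewrite (proper_fine gp gxs) /=.
have := gNy x; case: (g x) => [r _| _ _|]; [|exact: leey|by rewrite eqxx].
by rewrite -!EFinD !lee_fin !dotvE; lra.
Qed.

(** The affine minorant makes the objective [h] coercive, so a sublevel set lies in a compact box,
    where lower semicontinuity forces the infimum to be attained. *)
Lemma prox_exists g (a : R) x m c : 0 < a -> proper_fun g ->
  lower_semicontinuous g -> (forall y, ((m + dotv c y)%:E <= g y)%E) ->
  exists p, is_prox g a x p.
Proof.
move=> a0 gp glsc gmin; have [gNy [x1 gx1]] := gp.
pose h y := (a%:E * g y + (norm2 (y - x)%R / 2)%:E)%E.
(* Young's inequality with weight 2 bounds [a * dotv c (y - x)] below by
   [- a ^+ 2 * norm2 c - norm2 (y - x) / 4], which keeps half of the quadratic term. *)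
pose B := a * (m + dotv c x) - a ^+ 2 * norm2 c.
have hB y : ((B + norm2 (y - x)%R / 4)%:E <= h y)%E.
  rewrite /h; have := gmin y; have := gNy y.
  case: (g y) => [r _| _ _|]; [|by rewrite gt0_muley ?lte_fin// addye// leey|by rewrite eqxx].
  rewrite -EFinM -EFinD !lee_fin => mr.
  apply: (@le_trans _ _ (a * (m + dotv c y) + norm2 (y - x)%R / 2)); last first.
    by rewrite lerD2r ler_pM2l.
  have -> : dotv c y = dotv c x + dotv c (y - x) by rewrite -dotvDr addrC subrK.
  have := @young _ _ (- (a *: c)) (y - x) 2 (ltr0Sn _ _).
  by rewrite -scaleN1r !norm2Z !dotvE /B; lra.
have hx1 : h x1 = (fine (h x1))%:E by rewrite /h (proper_fine gp gx1).
pose T := 4 * (fine (h x1) - B).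
(* The half-width [1 + T] avoids a square root: [r ^+ 2 <= T] gives [|r| <= 1 + T]. *)
pose box i := `[x ord0 i - (1 + T), x ord0 i + (1 + T)]%classic.
pose K := [set v : 'rV[R]_d | forall i, box i (v ord0 i)].
have Kc : compact K by apply: (@rV_compact R d box) => i; exact: segment_compact.
have hK y : (h y <= h x1)%E -> K y.
  move=> hy i; have yT : norm2 (y - x) <= T.
    have := le_trans (hB y) hy.
    by rewrite hx1 lee_fin /T; lra.
  have : ((y - x) ord0 i) ^+ 2 <= norm2 (y - x).
    rewrite /norm2 /dotv (bigD1 i) //= expr2 lerDl.
    by apply: sumr_ge0 => j _; rewrite -expr2 sqr_ge0.
  rewrite /box /= in_itv /= !mxE => yi.
  have sq1 := sqr_ge0 (y ord0 i - x ord0 i - 1).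
  have sq2 := sqr_ge0 (y ord0 i - x ord0 i + 1).
  by apply/andP; split; nra.
pose i0 := ereal_inf (range h).
have i0h y : (i0 <= h y)%E by apply: ereal_inf_lbound; exists y.
have i0_fin : i0 \is a fin_num.
  rewrite fin_numE; apply/andP; split.
    rewrite -ltNye; apply: (@lt_le_trans _ _ B%:E); first exact: ltNyr.
    apply: le_ereal_inf_tmp => _ [y _ <-]; apply: le_trans (hB y).
    by rewrite lee_fin lerDl divr_ge0 ?norm2_ge0.
  by rewrite -ltey; apply: le_lt_trans (i0h x1) _; rewrite hx1 ltry.
(* If the infimum [i0] of [h] were not attained, lower semicontinuity and
   compactness of [K] would give [h > e] on [K] for a single [e > i0]. *)
apply: contrapT => /forallNP noprox.
have i0_lt z : (i0 < h z)%E.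
  rewrite lt_neqAle i0h andbT; apply/eqP => i0z.
  by apply: (noprox z) => y; rewrite -/(h z) -i0z; exact: i0h.
have hlsc z (s : R) : (s%:E < h z)%E -> \forall z' \near z, (s%:E < h z')%E.
  move=> sz; have [s' ss' s'z] : exists2 s' : R,
      s < a * s' + norm2 (z - x) / 2 & (s'%:E < g z)%E.
    move: sz; rewrite /h; have := gNy z; case: (g z) => [r _| |] //=.
      rewrite -EFinM -EFinD lte_fin => sz.
      (* Lowering [g z] by [dl] uses up half of the slack between [s] and [h z]. *)
      pose dl := (a * r + norm2 (z - x) / 2 - s) / (2 * a).
      have adl : a * dl = (a * r + norm2 (z - x) / 2 - s) / 2.
        by rewrite /dl; field; rewrite gt_eqF.
      have dl0 : 0 < dl by rewrite /dl divr_gt0 ?mulr_gt0// subr_gt0.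
      by exists (r - dl); rewrite ?lte_fin ?ltrBlDr ?ltrDl// mulrBr adl; lra.
    move=> _ _; exists ((s - norm2 (z - x) / 2 + 1) / a); last by rewrite ltry.
    by rewrite mulrC divfK ?gt_eqF//; lra.
  have [V Vz Vg] := glsc z s' s'z.
  have n_near : \forall z' \near z, 2 * (s - a * s') < norm2 (z' - x).
    have /cvgr_gt nz := @continuous_norm2B x z.
    by apply: nz; lra.
  near=> z'.
  have gz' : (s'%:E < g z')%E by apply: Vg; near: z'.
  have nz' : 2 * (s - a * s') < norm2 (z' - x) by near: z'.
  apply: (@lt_le_trans _ _ (a * s' + norm2 (z' - x) / 2)%:E).
    by rewrite lte_fin; lra.
  by rewrite EFinD leeD2r// EFinM lee_pmul2l// ltW.
have [e [i0e Ke]] : exists e : R, (i0 < e%:E)%E /\ forall z, K z -> (e%:E < h z)%E.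
  have Knear : \forall e \near at_right (fine i0), K `<=` (fun z => (e%:E < h z)%E).
    move/compact_near_coveringP : Kc; apply => z _.
    have [s i0s sz] : exists2 s : R, fine i0 < s & (s%:E < h z)%E.
      have := i0_lt z; rewrite -(fineK i0_fin); case: (h z) => [r| |] //=.
        rewrite lte_fin => i0r; exists ((fine i0 + r) / 2); rewrite ?lte_fin; lra.
      by move=> _; exists (fine i0 + 1); rewrite ?ltry// ltrDl.
    near=> z' e => /=.
    apply: (@lt_trans _ _ s%:E); last by near: z'; exact: hlsc.
    by rewrite lte_fin; near: e; exact: nbhs_right_lt.
  have i0near : \forall e \near at_right (fine i0), fine i0 < e by exact: nbhs_right_gt.
  have [e [i0e Ke]] := filter_ex (filterI i0near Knear).
  by exists e; split => //; rewrite -(fineK i0_fin) lte_fin.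
(* Either [y] lies in [K], or [h y] exceeds [h x1] with [x1] in [K]; both contradict [Ke]. *)
have [y _ hye] : exists2 y, True & (h y < e%:E)%E.
  have [_ [y _ <-] ?] := ereal_inf_lt i0e; by exists y.
have [yx1|x1y] := leP (h y) (h x1).
  by have := lt_trans (Ke _ (hK _ yx1)) hye; rewrite ltxx.
by have := lt_trans (lt_trans (Ke _ (hK _ (lexx _))) x1y) hye; rewrite ltxx.
Unshelve. all: by end_near.
Qed.

(** Replaces the passage to the limit [t -> 0]. *)
Lemma ge0_of_add_mul (A B : R) : 0 <= B ->
  (forall t, 0 < t <= 1 -> 0 <= A + t * B) -> 0 <= A.
Proof.
move=> B0 AB; rewrite leNgt; apply/negP => A0.
have BA : 0 < B - A by lra.
(* At this [t] the value of [A + t * B] is [- A ^+ 2 / (B - A)], which is negative. *)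
have := AB (- A / (B - A)); rewrite divr_gt0 ?oppr_gt0//= ler_pdivrMr// mul1r lerDr B0.
move=> /(_ isT); rewrite -(pmulr_rge0 _ BA).
have -> : (B - A) * (A + - A / (B - A) * B) = - A ^+ 2 by field; rewrite gt_eqF.
by nra.
Qed.

Lemma is_prox_fin g a x p : 0 < a -> proper_fun g -> is_prox g a x p -> (g p < +oo)%E.
Proof.
move=> a0 gp px; have [gNy [x1 gx1]] := gp.
rewrite ltey; apply/eqP => gpy; have := px x1.
by rewrite gpy (proper_fine gp gx1) gt0_muley ?lte_fin// addye.
Qed.

(** Minimality of [p] is tested at [t *: u + (1 - t) *: p]; convexity and division by [t] leave an
    error linear in [t]. *)
Lemma is_prox_ineq g a x p u : 0 < a -> proper_fun g -> convex_efun g ->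
  is_prox g a x p -> (g u < +oo)%E ->
  a * (fine (g p) - fine (g u)) <= dotv (p - x) (u - p).
Proof.
move=> a0 gp gc px gu; have gpf := is_prox_fin a0 gp px.
rewrite -subr_ge0; apply: (@ge0_of_add_mul _ (norm2 (u - p) / 2)).
  by rewrite divr_ge0 ?norm2_ge0.
move=> t /andP[t0 t1].
have t01 : 0 <= t <= 1 by rewrite ltW.
have := gc u p t t01; rewrite (proper_fine gp gu) (proper_fine gp gpf).
rewrite -!EFinM -EFinD => gt.
have gtf : (g (t *: u + (1 - t) *: p)%R < +oo)%E by apply: le_lt_trans gt (ltry _).
move: gt (px (t *: u + (1 - t) *: p)).
rewrite (proper_fine gp gtf) (proper_fine gp gpf) -!EFinM -!EFinD !lee_fin.
have -> : t *: u + (1 - t) *: p - x = (p - x) + t *: (u - p).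
  by apply/rowP => i; rewrite !mxE; ring.
rewrite (norm2D (p - x)) norm2Z dotvZr => gt.
rewrite -(ler_pM2l a0) in gt.
move=> h; rewrite -(pmulr_rge0 _ t0); nra.
Qed.

End Prox.

(** [ring] sees [dotv a b] and [dotv b a] as distinct atoms; when both occur, they are oriented the
    same way. *)
Ltac dotv_comm := repeat match goal with |- context [dotv ?a ?b] =>
  match goal with |- context [dotv b a] =>
    tryif constr_eq a b then fail else rewrite (dotvC a b) end end.

(** * One iteration with given sampling noise and coin *)

Section OneStep.
Context {R : realType} {d : nat}.
Variables (F : 'rV[R]_d -> 'rV[R]_d) (g : 'rV[R]_d -> \bar R).
Variables (eta gamma : R) (x0 : 'rV[R]_d).
Implicit Types (s : state R d) (u e N : 'rV[R]_d).

(* [e] stands for the sampling noise and [c] for the coin of the step. *)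
Definition next_x s e : 'rV[R]_d :=
  prox g eta (sx s + gamma *: (sw s - sx s) - eta *: (2 *: F (sx s) - F (sxp s) + e)).

Definition next_state s e (c : bool) : state R d :=
  State (next_x s e) (sx s) (if c then next_x s e else sw s) (sw s).

(** The conditional mean of the coin is written with [gamma], which is also the probability of the
    coin. *)
Definition xi s e c : 'rV[R]_d :=
  (2 * eta) *: e
  - 2 *: (sw (next_state s e c) - (gamma *: next_x s e + (1 - gamma) *: sw s)).

(* The part of the one-step bound free of [u]; its first four terms are a
   martingale difference. *)
Definition incr s e c : R :=
  norm2 (sw (next_state s e c) - x0)
  - gamma * norm2 (next_x s e - x0) - (1 - gamma) * norm2 (sw s - x0)
  - 2 * eta * dotv e (sx s - x0)
  - (1 - gamma) * norm2 (next_x s e - sx s) - gamma * norm2 (next_x s e - sw s)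
  - 2 * eta * dotv (F (sx s) - F (sxp s)) (next_x s e - sx s)
  - 2 * eta * dotv e (next_x s e - sx s).

(** The inner product is the optimistic correction: writing [2 *: F x - F xp] as
    [F xn + (F x - F xp) - (F xn - F x)] makes it telescope. *)
Definition lyap s u : R :=
  (1 - gamma) * norm2 (sx s - u) + norm2 (sw s - u)
  - 2 * eta * dotv (F (sx s) - F (sxp s)) (sx s - u).

(* [W_k], with [N] and [a] the sums of the past [xi] and [incr]. *)
Definition pot s N (a : R) : R :=
  norm2 N / 8 + a + norm2 (sx s - sxp s) / 4 + gamma / 2 * norm2 (sx s - swp s).

Definition gap_term u x : R := dotv (F u) (x - u) + fine (g x) - fine (g u).

Hypotheses (eta_gt0 : 0 < eta) (gamma_ge0 : 0 <= gamma) (gamma_le : gamma <= 1 / 16).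
Hypotheses (gp : proper_fun g) (gc : convex_efun g).
Hypothesis proxP : forall x, is_prox g eta x (prox g eta x).
Hypothesis F_mono : monotone_op F.
Hypothesis F_lip : forall u v, norm2 (eta *: (F u - F v)) <= norm2 (u - v) / 64.

(* The slack is 2 (prox inequality) + 2 eta (monotonicity), an identity between
   inner products. *)
Lemma lyap_next s e c u : (g u < +oo)%E ->
  2 * eta * gap_term u (next_x s e) <=
  lyap s u - lyap (next_state s e c) u + dotv (xi s e c) (u - x0) + incr s e c.
Proof.
move=> gu.
have := is_prox_ineq eta_gt0 gp gc (proxP (sx s + gamma *: (sw s - sx s)
  - eta *: (2 *: F (sx s) - F (sxp s) + e))) gu.
rewrite -/(next_x s e).
have := F_mono (next_x s e) u; rewrite -(pmulr_rge0 _ eta_gt0).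
rewrite /lyap /incr /xi /gap_term /=.
set xn := next_x s e; set wn := (if c then _ else _).
set Fx := F (sx s); set Fxp := F (sxp s); set Fn := F xn; set Fu := F u.
set x := sx s; set w := sw s.
set gx := fine (g xn); set gu' := fine (g u).
(* The identity holds for arbitrary [wn], so no case split on the coin is made. *)
move: xn wn Fx Fxp Fn Fu x w gx gu' => xn wn Fx Fxp Fn Fu x w gx gu'.
set P := dotv _ _; set Q := dotv _ _ => mono pr.
rewrite -subr_ge0.
(* Rewriting with this implication turns the goal into [true] and leaves the identity as a side
   condition. *)
have -> : forall X, X = 2 * (eta * P) + 2 * (Q - eta * (gx - gu')) -> 0 <= X.
  by move=> X ->; lra.
by [].
rewrite /P /Q /norm2 !dotvE.
by dotv_comm; ring.
Qed.

(** Young's inequality with weight 8 balances the factor [1 / 64] of [F_lip] into [1 / 8] on each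
    side. *)
Lemma young_F s u :
  `|2 * eta * dotv (F (sx s) - F (sxp s)) u| <= norm2 (sx s - sxp s) / 8 + norm2 u / 8.
Proof.
have h (v : 'rV[R]_d) : norm2 v = norm2 u ->
    2 * dotv (eta *: (F (sx s) - F (sxp s))) v <= norm2 (sx s - sxp s) / 8 + norm2 u / 8.
  move=> <-; have := @young _ _ (eta *: (F (sx s) - F (sxp s))) v 8 (ltr0Sn _ _).
  by have := F_lip (sx s) (sxp s); lra.
rewrite ler_norml; have := h u erefl; have := h (- u).
rewrite -scaleN1r norm2Z sqrrN expr1n mul1r => /(_ erefl).
by rewrite !dotvZl dotvZr; lra.
Qed.

(** The coin is averaged with [e] fixed. The total coefficients of [norm2 (xn - x)] and
    [norm2 (xn - w)], namely [gamma - 1 / 8] and [- gamma ^+ 2 / 2], are nonpositive. The [5 / 2] is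
    [1 / 2] from the square of [(2 * eta) *: e] over 8, plus 2 from [he]. *)
Lemma incr_mean s e N (a : R) :
  gamma * pot (next_state s e true) (N + xi s e true) (a + incr s e true)
  + (1 - gamma) * pot (next_state s e false) (N + xi s e false) (a + incr s e false)
  <= norm2 N / 8 + a + norm2 (sx s - sxp s) / 8
     + dotv ((eta / 2) *: N - (2 * eta) *: (sx s - x0)) e
     + 5 / 2 * (eta ^+ 2 * norm2 e).
Proof.
have /ler_normlP[hF _] := young_F s (next_x s e - sx s).
have he : - (2 * eta * dotv e (next_x s e - sx s))
    <= 2 * (eta ^+ 2 * norm2 e) + norm2 (next_x s e - sx s) / 2.
  have := @young _ _ (- (eta *: e)) (next_x s e - sx s) 2 (ltr0Sn _ _).
  by rewrite -scaleN1r !norm2Z sqrrN expr1n mul1r !dotvZl; lra.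
have hx : 0 <= (1 / 16 - gamma) * norm2 (next_x s e - sx s).
  by rewrite mulr_ge0 ?norm2_ge0// subr_ge0.
have hx0 := norm2_ge0 (next_x s e - sx s).
have hw : 0 <= gamma ^+ 2 * norm2 (next_x s e - sw s).
  by rewrite mulr_ge0 ?norm2_ge0// sqr_ge0.
rewrite /pot /incr /xi /=.
move: hF he hx hx0 hw.
set xn := next_x s e; set Fd := F (sx s) - F (sxp s).
set x := sx s; set w := sw s; set xp := sxp s.
set A := dotv Fd _; set B := dotv e (xn - x); set C := norm2 (xn - x).
set D := norm2 (xn - w).
move=> hF he hx hx0 hw.
(* The coin noise is [(1 - gamma) *: (xn - w)] or [- gamma *: (xn - w)]: on averaging, the cross
   terms cancel and the squares give [4 * gamma * (1 - gamma) * D]. *)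
have xi1 : norm2 (N + ((2 * eta) *: e - 2 *: (xn - (gamma *: xn + (1 - gamma) *: w))))
   = norm2 (N + (2 * eta) *: e) - 4 * (1 - gamma) * dotv (N + (2 * eta) *: e) (xn - w)
     + 4 * (1 - gamma) ^+ 2 * D.
  by rewrite /D /norm2 !dotvE; dotv_comm; ring.
have xi2 : norm2 (N + ((2 * eta) *: e - 2 *: (w - (gamma *: xn + (1 - gamma) *: w))))
   = norm2 (N + (2 * eta) *: e) + 4 * gamma * dotv (N + (2 * eta) *: e) (xn - w)
     + 4 * gamma ^+ 2 * D.
  by rewrite /D /norm2 !dotvE; dotv_comm; ring.
rewrite {}xi1 {}xi2 (norm2D N) norm2Z.
have -> : dotv ((eta / 2) *: N - (2 * eta) *: (x - x0)) e
    = eta / 2 * dotv N e - 2 * eta * dotv e (x - x0).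
  by rewrite dotvDl dotvNl !dotvZl (dotvC (x - x0)).
rewrite (dotvZr (2 * eta) N).
by lra.
Qed.

End OneStep.

(** * Batch sampling noise and the supermartingale *)

Section Sampling.
Context {R : realType} {d M b : nat}.
Variables (g : 'rV[R]_d -> \bar R) (Fm : 'I_M -> 'rV[R]_d -> 'rV[R]_d) (Lm : 'I_M -> R).
Variables (eta gamma : R) (x0 : 'rV[R]_d).
Local Notation F := (Favg Fm).
Implicit Types (s : state R d) (S : seq 'I_M) (o : outcome M b).

Hypotheses (M_gt0 : (0 < M)%N) (b_gt0 : (0 < b)%N).
Hypothesis Fm_lip : forall m, lipschitz_op (Fm m) (Lm m).
Hypotheses (gamma_ge0 : 0 <= gamma) (gamma_le : gamma <= 1 / 16).
Hypothesis eta_Lm :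
  64 * eta ^+ 2 * ((M%:R)^-1 * \sum_(m < M) Lm m ^+ 2) <= gamma * b%:R.

Let unif (j : 'I_M) : R := M%:R^-1.

Let unif_ge0 j : 0 <= unif j. Proof. by rewrite invr_ge0. Qed.

Let unif_sum1 : \sum_j unif j = 1.
Proof. by rewrite sumr_const card_ord -[LHS]mulr_natl mulfV// pnatr_eq0 -lt0n. Qed.

Definition sample s (j : 'I_M) : 'rV[R]_d :=
  Fm j (sx s) - Fm j (swp s) + (Fm j (sx s) - Fm j (sxp s)).

Definition sample_mean s : 'rV[R]_d := \sum_j unif j *: sample s j.

Definition err s S : 'rV[R]_d :=
  (b%:R)^-1 *: \sum_(j <- S) (sample s j - sample_mean s).

Lemma sample_meanE s : sample_mean s = 2 *: F (sx s) - F (sxp s) - F (swp s).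
Proof.
rewrite /sample_mean -scaler_sumr /Favg /sample big_split /= !sumrB.
by rewrite !(scalerDr, scalerN) scaler_nat mulr2n; apply/rowP => i; rewrite !mxE; ring.
Qed.

(** The term [F (swp s)] added to the batch mean cancels the one in [sample_mean], so [err] is the
    whole deviation from the optimistic direction. *)
Lemma alg_stepE s o :
  alg_step Fm g eta gamma s o = next_state F g eta gamma s (err s o.1) o.2.
Proof.
case: o s => S c [x xp w wp]; rewrite /next_state /next_x /=.
suff -> : (b%:R)^-1 *: \sum_(j <- S) (Fm j x - Fm j wp + (Fm j x - Fm j xp)) + F wp
    = 2 *: F x - F xp + err (State x xp w wp) S by [].
rewrite /err sumrB big_const_seq count_predT size_tuple iter_addr_0.
rewrite -(scaler_nat b (sample_mean _)) scalerBr (scalerA b%:R^-1) mulVf ?pnatr_eq0 -?lt0n//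
  scale1r sample_meanE /sample /=.
by apply/rowP => i; rewrite !mxE; ring.
Qed.

Lemma sample_centered s : \sum_j unif j *: (sample s j - sample_mean s) = 0.
Proof.
under eq_bigr do rewrite scalerBr.
by rewrite sumrB -scaler_suml unif_sum1 scale1r subrr.
Qed.

Lemma err_mean s a : Ex unif b (fun S => dotv a (err s S)) = 0.
Proof.
under eq_fun do rewrite dotvZr.
by rewrite ExZ (Ex_dotv_sum unif_sum1 (sample_centered s)) mulr0.
Qed.

(** Independence gives a factor [1 / b]; the second moment of one sample is at most twice the mean
    of [Lm m ^+ 2] times [n], and [eta_Lm] turns 2 into [gamma * b / 32]. *)
Lemma err_variance s :
  eta ^+ 2 * Ex unif b (fun S => norm2 (err s S)) <=
  gamma / 32 * (norm2 (sx s - swp s) + norm2 (sx s - sxp s)).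
Proof.
set n := norm2 (sx s - swp s) + norm2 (sx s - sxp s).
have n0 : 0 <= n by rewrite addr_ge0 ?norm2_ge0.
have bR : 0 < b%:R :> R by rewrite ltr0n.
under eq_fun do rewrite norm2Z.
rewrite ExZ (Ex_norm2_sum unif_sum1 (sample_centered s)).
have var : \sum_j unif j * norm2 (sample s j - sample_mean s) <=
    2 * n * ((M%:R)^-1 * \sum_(m < M) Lm m ^+ 2).
  apply: le_trans (variance_le unif_sum1 _) _.
  rewrite mulrCA big_distrr /= -big_distrr /= ler_wpM2l ?invr_ge0//.
  apply: ler_sum => j _; apply: le_trans (norm2D_le _ _) _.
  have := lipschitz_norm2 (sx s) (swp s) (Fm_lip j).
  have := lipschitz_norm2 (sx s) (sxp s) (Fm_lip j).
  by rewrite /n; lra.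
move: var; set V := \sum_j _; set L2 := _^-1 * _ => var.
have -> : eta ^+ 2 * (b%:R^-1 ^+ 2 * (b%:R * V)) = b%:R^-1 * (eta ^+ 2 * V).
  by field; rewrite gt_eqF.
rewrite ler_pdivrMl//.
apply: (@le_trans _ _ (eta ^+ 2 * (2 * n * L2))).
  by rewrite ler_wpM2l ?sqr_ge0.
by have := ler_wpM2l n0 eta_Lm; rewrite -/L2; lra.
Qed.

Lemma outcome_prob_ge0 o : 0 <= outcome_prob gamma o.
Proof.
rewrite /outcome_prob; apply: mulr_ge0; first by rewrite invr_ge0 exprn_ge0.
by move: gamma_ge0 gamma_le; case: (o.2) => /= ? ?; lra.
Qed.

(** Separates the batch, uniform on tuples, from the independent coin. *)
Lemma sum_outcome (f : b.-tuple 'I_M -> bool -> R) :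
  \sum_(o : outcome M b) outcome_prob gamma o * f o.1 o.2 =
  \sum_(S : b.-tuple 'I_M) (\prod_(j <- S) unif j) *
    (gamma * f S true + (1 - gamma) * f S false).
Proof.
rewrite -(pair_bigA _ (fun (S : b.-tuple _) c => outcome_prob gamma (S, c) * f S c)) /=.
apply: eq_bigr => S _; rewrite big_bool /outcome_prob /=.
by rewrite big_const_seq count_predT size_tuple iter_mulr_1 exprVn; ring.
Qed.

Lemma sum_outcome_prob : \sum_(o : outcome M b) outcome_prob gamma o = 1.
Proof.
rewrite -[RHS](Ex_cst unif_sum1 b); under eq_bigr do rewrite -[outcome_prob _ _]mulr1.
by rewrite (sum_outcome (fun _ _ => 1)); apply: eq_bigr => S _; ring.
Qed.

(** The state does not determine the accumulated [N] and [a], so they are carried along with it. *)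
Definition noise_step (q : state R d * 'rV[R]_d * R) o :=
  let: (s, N, a) := q in let e := err s o.1 in
  (alg_step Fm g eta gamma s o, N + xi F g eta gamma s e o.2,
   a + incr F g eta gamma x0 s e o.2).

Definition noise_run (os : seq (outcome M b)) :=
  foldl noise_step (alg_init x0, 0, 0) os.

Definition noise_pot (os : seq (outcome M b)) : R :=
  let: (s, N, a) := noise_run os in pot gamma s N a.

Lemma noise_run_rcons os o : noise_run (rcons os o) = noise_step (noise_run os) o.
Proof. by rewrite /noise_run foldl_rcons. Qed.

Lemma run_rcons os o :
  run Fm g eta gamma x0 (rcons os o) = alg_step Fm g eta gamma (run Fm g eta gamma x0 os) o.
Proof. by rewrite /run foldl_rcons. Qed.

Lemma noise_run_state os : (noise_run os).1.1 = run Fm g eta gamma x0 os.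
Proof.
elim/last_ind: os => [|os o IH]//.
rewrite noise_run_rcons run_rcons -IH.
by case: (noise_run os) => [[s N] a].
Qed.

Hypothesis F_lip : forall u v, norm2 (eta *: (F u - F v)) <= norm2 (u - v) / 64.

(** The coin is averaged first, then the batch. The vector [v] depends on the past only, so the
    linear term has mean zero; the variance term is absorbed by [X / 8] and [gamma / 2 * Y]. *)
Lemma noise_pot_supermartingale os :
  \sum_o outcome_prob gamma o * noise_pot (rcons os o) <= noise_pot os.
Proof.
rewrite /noise_pot; under eq_bigr do rewrite noise_run_rcons.
case: (noise_run os) => [[s N] a] /=.
under eq_bigr do rewrite alg_stepE.
rewrite (sum_outcome (fun (S : b.-tuple _) c => pot gamma (next_state F g eta gamma s (err s S) c)
  (N + xi F g eta gamma s (err s S) c) (a + incr F g eta gamma x0 s (err s S) c))).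
set A := norm2 N / 8 + a + norm2 (sx s - sxp s) / 8.
set v := (eta / 2) *: N - (2 * eta) *: (sx s - x0).
apply: (@le_trans _ _ (Ex unif b (fun S =>
    A + dotv v (err s S) + 5 / 2 * eta ^+ 2 * norm2 (err s S)))).
  apply: ler_sum => S _; rewrite ler_wpM2l ?prodr_ge0//.
  apply: le_trans (incr_mean g x0 gamma_le F_lip s (err s S) N a) _.
  by rewrite /A (mulrA (5 / 2)).
rewrite (ExD _ b (fun S => A + _)) (ExD _ b (fun=> A)) (Ex_cst unif_sum1 b A)
  err_mean ExZ -(mulrA (5 / 2)) /pot.
have := err_variance s; rewrite /A.
have := norm2_ge0 (sx s - swp s); have := norm2_ge0 (sx s - sxp s).
set X := norm2 (sx s - sxp s); set Y := norm2 (sx s - swp s) => X0 Y0.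
have := mulr_ge0 gamma_ge0 Y0.
have : 0 <= (1 / 16 - gamma) * X by rewrite mulr_ge0// subr_ge0.
by lra.
Qed.

End Sampling.

(** * Jensen's inequality for uniform averages *)

Section Jensen.
Context {R : realType} {d : nat}.

Lemma convex_avg (g : 'rV[R]_d -> \bar R) (f : nat -> 'rV[R]_d) n :
  proper_fun g -> convex_efun g -> (forall k, (k <= n)%N -> (g (f k) < +oo)%E) ->
  (g ((n.+1%:R)^-1 *: \sum_(k < n.+1) f k)
     <= ((n.+1%:R)^-1 * \sum_(k < n.+1) fine (g (f k)))%:E)%E.
Proof.
move=> gp gc; elim: n => [|n IH] gf.
  by rewrite !big_ord_recr !big_ord0 /= !add0r invr1 scale1r mul1r -proper_fine ?gf.
(* The new point gets weight [1 / (n + 2)] and the average of the first [n + 1] points gets the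
   rest. *)
pose t : R := n.+2%:R^-1.
have t01 : 0 <= t <= 1 by rewrite invr_ge0 ler0n invf_le1 ?ler1n ?ltr0n.
have tE : 1 - t = n.+1%:R / n.+2%:R.
  have n2 : n.+2%:R != 0 :> R by rewrite pnatr_eq0.
  by apply: (mulIf n2); rewrite mulrBl mulVf// divfK// mul1r -[n.+2%:R]natr1 addrK.
have n1 : n.+1%:R != 0 :> R by rewrite pnatr_eq0.
rewrite big_ord_recr /= [in X in (_ <= X)%E]big_ord_recr /=.
set A := \sum_(k < n.+1) f k; set B := \sum_(k < n.+1) fine _.
have -> : n.+2%:R^-1 *: (A + f n.+1) = t *: f n.+1 + (1 - t) *: (n.+1%:R^-1 *: A).
  by rewrite scalerA tE scalerDr addrC; congr (_ + _ *: _); rewrite mulrAC mulfV// mul1r.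
apply: le_trans (gc _ _ _ t01) _.
rewrite (proper_fine gp (gf n.+1 (leqnn _))) -EFinM.
have -> : n.+2%:R^-1 * (B + fine (g (f n.+1)))
    = t * fine (g (f n.+1)) + (1 - t) * (n.+1%:R^-1 * B).
  by rewrite mulrA tE mulrDr addrC; congr (_ + _ * _); rewrite mulrAC mulfV// mul1r.
rewrite [leRHS]EFinD leeD2l// [leRHS]EFinM; apply: lee_wpmul2l.
  by rewrite lee_fin subr_ge0; case/andP: t01.
by apply: IH => k kn; apply: gf; rewrite (leq_trans kn).
Qed.

End Jensen.

(** * From the pathwise bound to the expected gap *)

Section GapBound.
Context {R : realType} {d M b : nat}.
Variables (g : 'rV[R]_d -> \bar R) (Fm : 'I_M -> 'rV[R]_d -> 'rV[R]_d) (Lm : 'I_M -> R).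
Variables (eta gamma : R) (x0 : 'rV[R]_d).
Local Notation F := (Favg Fm).
Implicit Types (u : 'rV[R]_d) (os : seq (outcome M b)).

Hypotheses (M_gt0 : (0 < M)%N) (b_gt0 : (0 < b)%N).
Hypothesis Fm_lip : forall m, lipschitz_op (Fm m) (Lm m).
Hypotheses (gamma_ge0 : 0 <= gamma) (gamma_le : gamma <= 1 / 16).
Hypothesis eta_Lm :
  64 * eta ^+ 2 * ((M%:R)^-1 * \sum_(m < M) Lm m ^+ 2) <= gamma * b%:R.
Hypothesis F_lip : forall u v, norm2 (eta *: (F u - F v)) <= norm2 (u - v) / 64.
Hypotheses (eta_gt0 : 0 < eta) (gp : proper_fun g) (gc : convex_efun g).
Hypothesis proxP : forall x, is_prox g eta x (prox g eta x).
Hypothesis F_mono : monotone_op F.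

Local Notation iter_run := (run Fm g eta gamma x0).
Local Notation pot_of := (noise_pot g Fm eta gamma x0).

(** The starting point may lie outside the domain of [g], but every later iterate is a proximal
    point. *)
Lemma run_fin os : (0 < size os)%N -> (g (sx (iter_run os)) < +oo)%E.
Proof.
elim/last_ind: os => [|os o _]// _.
rewrite run_rcons (alg_stepE _ _ _ _ b_gt0).
exact: (is_prox_fin eta_gt0 gp (proxP _)).
Qed.

Lemma sum_gap_le_lyap u os : (g u < +oo)%E ->
  \sum_(k < size os) 2 * eta * gap_term F g u (sx (iter_run (take k.+1 os))) <=
  lyap F eta gamma (alg_init x0) u - lyap F eta gamma (iter_run os) u
  + dotv (noise_run g Fm eta gamma x0 os).1.2 (u - x0)
  + (noise_run g Fm eta gamma x0 os).2.
Proof.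
move=> gu; elim/last_ind: os => [|os o IH].
  by rewrite big_ord0 /= dotvC dotv0 subrr !addr0.
rewrite size_rcons big_ord_recr /= take_oversize ?size_rcons//.
under eq_bigr => k _ do rewrite -cats1 takel_cat ?ltn_ord// .
move: IH; rewrite noise_run_rcons run_rcons -noise_run_state.
case: (noise_run _ _ _ _ _ os) => [[s N] a] /= IH.
rewrite (alg_stepE _ _ _ _ b_gt0).
have := lyap_next gamma x0 eta_gt0 gp gc proxP F_mono s (err (b := b) Fm s o.1) o.2 gu.
rewrite dotvDl /=; move: IH; lra.
Qed.

(** The initial [lyap] contributes [2 - gamma] to the constant 4, and Young's inequality on the
    noise term contributes 2. The final [lyap] is at least [- norm2 (sx s - sxp s) / 8], which [pot]
    covers. *)
Lemma sum_gap_le u os : (g u < +oo)%E ->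
  \sum_(k < size os) 2 * eta * gap_term F g u (sx (iter_run (take k.+1 os))) <=
  4 * norm2 (x0 - u) + pot_of os.
Proof.
move=> gu; apply: le_trans (sum_gap_le_lyap os gu) _.
rewrite /noise_pot -noise_run_state.
case: (noise_run _ _ _ _ _ os) => [[s N] a] /=.
have := young_F F_lip s (sx s - u).
rewrite ler_norml /pot /lyap /= subrr (dotvC 0) dotv0 => /andP[_ hF].
have hN := @young _ _ N (u - x0) (1 / 4) (divr_gt0 ltr01 (ltr0Sn _ 3)).
rewrite invf_div divr1 (norm2BC u) in hN.
have := mulr_ge0 gamma_ge0 (norm2_ge0 (x0 - u)).
have := mulr_ge0 gamma_ge0 (norm2_ge0 (sx s - swp s)).
have := norm2_ge0 (sw s - u); have := norm2_ge0 (sx s - sxp s).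
have : 0 <= (1 / 16 - gamma) * norm2 (sx s - u) by rewrite mulr_ge0 ?norm2_ge0// subr_ge0.
have := norm2_ge0 (sx s - u).
by lra.
Qed.

Lemma gap_le (C : set 'rV[R]_d) (D2 : R) K (t : K.-tuple (outcome M b)) :
  (0 < K)%N -> (forall u, C u -> norm2 (x0 - u) <= D2) ->
  (gap F g C (xbar Fm g eta gamma x0 t)
    <= ((4 * D2 + pot_of t) / (2 * eta * K%:R))%:E)%E.
Proof.
case: K t => // n t _ CD; apply: ge_ereal_sup => _ [u Cu <-].
set z := xbar _ _ _ _ _ _.
have fin_t k : (k <= n)%N -> (g (sx (iter_run (take k.+1 t))) < +oo)%E.
  by move=> kn; apply: run_fin; rewrite size_takel ?size_tuple.
have gz : (g z <= ((n.+1%:R)^-1 *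
    \sum_(k < n.+1) fine (g (sx (iter_run (take k.+1 t)))))%:E)%E.
  exact: (convex_avg (f := fun k => sx (iter_run (take k.+1 t))) gp gc fin_t).
have gzf : (g z < +oo)%E by apply: le_lt_trans gz (ltry _).
(* Where [g u] is [+oo] the gap term is [-oo], so only finite [g u] matters. *)
have gNy := gp.1 u; case guE : (g u) gNy => [r| |] //= _; last first.
  by rewrite addeNy leNye.
have gu : (g u < +oo)%E by rewrite guE ltry.
move: gz; rewrite (proper_fine gp gzf) -!EFinD !lee_fin => gz.
have K0 : 0 < n.+1%:R :> R by rewrite ltr0n.
have := sum_gap_le t gu; rewrite size_tuple -big_distrr /= /gap_term.
rewrite !big_split /= !sumr_const card_ord guE /=.
rewrite -(dotv_sumr _ _ (fun k : 'I_n.+1 => sx (iter_run (take k.+1 t)) - u) (F u)).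
have -> : \sum_(k < n.+1) (sx (iter_run (take k.+1 t)) - u) = n.+1%:R *: (z - u).
  rewrite sumrB sumr_const card_ord scalerBr (scaler_nat _ u); congr (_ - _).
  by rewrite /z /xbar scalerA mulfV ?gt_eqF// scale1r.
rewrite dotvZr mulNrn -[r *+ _]mulr_natl => hs.
rewrite ler_pdivlMr ?mulr_gt0//.
apply: le_trans (_ : _ <= 4 * norm2 (x0 - u) + pot_of t) _; last first.
  by rewrite lerD2r ler_pM2l// CD.
apply: le_trans hs.
rewrite ler_pdivlMl// in gz.
by have := ler_wpM2l (ltW eta_gt0) gz; lra.
Qed.

Lemma expected_gap_le (C : set 'rV[R]_d) (D2 : R) K :
  (0 < K)%N -> (forall u, C u -> norm2 (x0 - u) <= D2) ->
  (expected_gap b Fm g eta gamma gamma x0 C K <= (2 / (eta * K%:R) * D2)%:E)%E.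
Proof.
move=> K0 CD.
have mu_ge0 := @outcome_prob_ge0 R M b gamma gamma_ge0 gamma_le.
have mu1 := @sum_outcome_prob R M b gamma M_gt0.
apply: (@le_trans _ _ (\sum_(t : K.-tuple (outcome M b))
  (path_prob gamma t * ((4 * D2 + pot_of t) / (2 * eta * K%:R)))%:E)%E).
  apply: lee_sum => t _; rewrite EFinM; apply: lee_wpmul2l; last exact: gap_le.
  by rewrite lee_fin /path_prob prodr_ge0.
rewrite sumEFin lee_fin.
have KR : 0 < K%:R :> R by rewrite ltr0n.
apply: (@le_trans _ _ (Ex (outcome_prob gamma) K
  (fun t => (2 * eta * K%:R)^-1 * (4 * D2 + pot_of t)))).
  by apply: ler_sum => t _; rewrite [X in _ * X]mulrC.
rewrite ExZ (ExD _ _ (fun=> _)) (Ex_cst mu1).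
(* The potential starts at 0, since both initial differences of iterates vanish. *)
have W0 : Ex (@outcome_prob R M b gamma) K pot_of <= 0.
  apply: le_trans (Ex_supermartingale mu_ge0 _ _) _.
    exact: (noise_pot_supermartingale g x0 M_gt0 b_gt0 Fm_lip gamma_ge0 gamma_le eta_Lm F_lip).
  by rewrite /noise_pot /pot /= !subrr norm20; lra.
rewrite ler_pdivrMl ?mulr_gt0//.
have -> : 2 * eta * K%:R * (2 / (eta * K%:R) * D2) = 4 * D2.
  by field; rewrite !gt_eqF.
by lra.
Qed.

End GapBound.

(** * Parameter choice and iteration count *)

Unset Implicit Arguments.
Set Strict Implicit.

Theorem theorem1 (R : realType) (d M b : nat)
  (g : 'rV[R]_d -> \bar R) (Fm : 'I_M -> 'rV[R]_d -> 'rV[R]_d)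
  (L : R) (Lm : 'I_M -> R) (x0 : 'rV[R]_d) (p gamma eta : R) :
  (0 < M)%N -> (0 < b)%N -> (b <= M)%N ->
  proper_fun g -> convex_efun g -> lower_semicontinuous g ->
  (exists xs, vi_solution (Favg Fm) g xs) ->
  monotone_op (Favg Fm) ->
  lipschitz_op (Favg Fm) L ->
  (forall m, lipschitz_op (Fm m) (Lm m)) ->
  0 < L ->
  let Lbar := Num.sqrt ((M%:R)^-1 * \sum_(m < M) Lm m ^+ 2) in
  0 < Lbar ->
  0 < p -> p = gamma -> gamma <= 1 / 16 ->
  eta = Num.min (Num.sqrt (gamma * b%:R) / (8 * Lbar)) (1 / (8 * L)) ->
  forall C : set 'rV[R]_d, C !=set0 -> compact C ->
  let D2 := sup [set norm2 (x0 - x) | x in C] in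
  (forall K : nat, (1 <= K)%N ->
     (expected_gap b Fm g eta gamma p x0 C K
        <= (2 / (eta * K%:R) * D2)%:E)%E)
  /\
  (forall (eps : R) (K : nat), 0 < eps -> (1 <= K)%N ->
     16 * (Lbar * D2 / (Num.sqrt (p * b%:R) * eps) + L * D2 / eps) <= K%:R ->
     (expected_gap b Fm g eta gamma p x0 C K <= eps%:E)%E).
Proof.
move=> M0 b0 _ gp gc glsc [xs vi] F_mono FL Fm_lip L0 Lbar Lbar0 p0 pE gamma_le etaE
  C C0 Cc D2.
subst p.
set sq := Num.sqrt (gamma * b%:R) in etaE *.
have sq0 : 0 < sq by rewrite sqrtr_gt0 mulr_gt0// ltr0n.
have sq2 : sq ^+ 2 = gamma * b%:R by rewrite sqr_sqrtr ?mulr_ge0 ?ler0n ?ltW.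
have Lbar2 : Lbar ^+ 2 = (M%:R)^-1 * \sum_(m < M) Lm m ^+ 2.
  by rewrite sqr_sqrtr// mulr_ge0 ?invr_ge0// sumr_ge0// => m _; exact: sqr_ge0.
have eta0 : 0 < eta by rewrite etaE lt_min !divr_gt0 ?mulr_gt0.
have eta1 : eta * (8 * Lbar) <= sq.
  by rewrite -ler_pdivlMr ?mulr_gt0// etaE ge_min lexx.
have eta2 : eta * (8 * L) <= 1.
  by rewrite -ler_pdivlMr ?mulr_gt0// etaE ge_min lexx orbT.
have eta_Lm : 64 * eta ^+ 2 * ((M%:R)^-1 * \sum_(m < M) Lm m ^+ 2) <= gamma * b%:R.
  rewrite -Lbar2 -sq2.
  have -> : 64 * eta ^+ 2 * Lbar ^+ 2 = (eta * (8 * Lbar)) ^+ 2 by ring.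
  by rewrite lerXn2r// nnegrE ltW// !mulr_gt0.
have F_lip u v : norm2 (eta *: (Favg Fm u - Favg Fm v)) <= norm2 (u - v) / 64.
  rewrite norm2Z; apply: le_trans (ler_wpM2l (sqr_ge0 _) (lipschitz_norm2 _ _ FL)) _.
  have h1 : (eta * (8 * L)) ^+ 2 <= 1 by rewrite exprn_ile1// ltW// !mulr_gt0.
  by have := ler_wpM2r (norm2_ge0 (u - v)) h1; lra.
(* Solvability of the variational inequality supplies the affine minorant, so the chosen [prox]
   really is a minimizer. *)
have [m [c gmin]] := vi_solution_minorant gp vi.
have proxP x : is_prox g eta x (prox g eta x).
  exact: xgetPex (prox_exists x eta0 gp glsc gmin).
have CD u : C u -> norm2 (x0 - u) <= D2.
  by move=> Cu; apply: (ub_le_sup (has_sup_norm2B x0 C0 Cc).2); exists u.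
have D20 : 0 <= D2.
  by case: C0 => u Cu; exact: le_trans (norm2_ge0 _) (CD u Cu).
have bound K : (1 <= K)%N ->
    (expected_gap b Fm g eta gamma gamma x0 C K <= (2 / (eta * K%:R) * D2)%:E)%E.
  by move=> K1; apply: (expected_gap_le M0 b0 Fm_lip (ltW p0) gamma_le eta_Lm F_lip).
split=> // eps K eps0 K1 Keps; apply: le_trans (bound K K1) _; rewrite lee_fin.
have KR : 0 < K%:R :> R by rewrite ltr0n.
(* The inverse of a minimum is the maximum of the inverses, at most their sum. *)
have inv_eta : eta^-1 <= 8 * Lbar / sq + 8 * L.
  have le1 : 1 <= eta * (8 * Lbar / sq + 8 * L).
    rewrite etaE; case: (leP (sq / (8 * Lbar)) (1 / (8 * L))) => _.
      rewrite [leRHS](_ : _ = 1 + L * sq / Lbar); last by field; rewrite !gt_eqF.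
      by rewrite lerDl divr_ge0 ?mulr_ge0 ?ltW.
    rewrite [leRHS](_ : _ = 1 + Lbar / (sq * L)); last by field; rewrite !gt_eqF.
    by rewrite lerDl divr_ge0 ?mulr_ge0 ?ltW.
  by rewrite -[leLHS]mulr1 ler_pdivrMl.
have -> : 2 / (eta * K%:R) * D2 = (2 * D2 * eta^-1) / K%:R.
  by field; rewrite !gt_eqF.
rewrite ler_pdivrMr//.
have D2' : 0 <= 2 * D2 by rewrite mulr_ge0.
apply: le_trans (ler_wpM2l D2' inv_eta) _.
have := ler_wpM2l (ltW eps0) Keps; apply: le_trans.
(* Both sides agree: the 16 is the 2 of the gap bound times the 8 in [inv_eta]. *)
by rewrite le_eqVlt; apply/orP; left; apply/eqP; field; rewrite !gt_eqF.
Qed.
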